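(* Let $d\ge 3$ be an odd integer and let $S$ be the semigroup (with identity, i.e. the submonoid) of $G_d$ generated by $A=\{a_1,\dots,a_d\}$. Then $S$ is a trace monoid (free partially commutative monoid). In particular, $S$ has the monoid presentation $$\langle a_1,\dots,a_d \;:\; a_ia_j=a_ja_i,\ 1<|j-i|<d-1\rangle .$$
   Context: Let $d\ge 3$ be odd and $X=\{1,\dots,d\}$. Let $T$ be the $d$-regular rooted tree whose vertex set is the set $X^*$ of finite words over $X$, with root the empty word, the children of $u$ being $ux$, $x\in X$. $\mathrm{Aut}(T)$ is the group of root-preserving graph automorphisms of $T$, with product $gh(u)=h(g(u))$ and identity $e$. For $g\in\mathrm{Aut}(T)$ and $u\in X^*$, the section $g|_u\in\mathrm{Aut}(T)$ is determined by $g(uv)=g(u)\,g|_u(v)$ for all $v\in X^*$. The wreath recursion of $g$ is $g=(g|_1,\dots,g|_d)\lambda_g$, where $\lambda_g\in S_d$ is the permutation induced by $g$ on $X$; it determines $g$. The group $G_d\le \mathrm{Aut}(T)$ is generated by $A=\{a_1,\dots,a_d\}$, defined recursively by: for $1\le i\le d-1$, $\lambda_{a_i}=(i\ \,i+1)$, $a_i|_i=a_i$, $a_i|_{i+1}=a_{i+1}$, and $a_i|_x=e$ for all other $x\in X$; and $\lambda_{a_d}=(d\ 1)$, $a_d|_1=a_1$, $a_d|_d=a_d$, and $a_d|_x=e$ for all other $x\in X$. A trace monoid is a monoid presented by a finite generating set with relations saying only that certain pairs of generators commute. *)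

(* Defs.v *)
From HB Require Import structures.
From mathcomp Require Import all_boot.
From mathcomp Require Import boolp classical_sets functions.

Set Implicit Arguments.
Unset Strict Implicit.
Unset Printing Implicit Defensive.

Local Open Scope classical_set_scope.
Local Open Scope group_scope.

Section Generated.
Variables (G : groupType) (A : set G).

Definition gen_group_set : set G :=
  smallest [set H : set G | group_closed [in H]] A.

Definition gen_monoid_set : set G :=
  smallest [set M : set G | monoid_closed [in M]] A.

Lemma gen_group_closed : group_closed [in gen_group_set].
Proof.
split; first by apply/mem_set => H [[H1 _] _]; exact: set_mem H1.
move=> x y xG yG; apply/mem_set => H HA; apply: set_mem.
by apply: (HA.1).2; apply/mem_set; [exact: (set_mem xG)|exact: (set_mem yG)].
Qed.

Lemma gen_monoid_closed : monoid_closed [in gen_monoid_set].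
Proof.
split; first by apply/mem_set => M [[M1 _] _]; exact: set_mem M1.
move=> x y xG yG; apply/mem_set => M MA; apply: set_mem.
by apply: (MA.1).2; apply/mem_set; [exact: (set_mem xG)|exact: (set_mem yG)].
Qed.

Lemma mem_gen_group x : A x -> x \in gen_group_set.
Proof. by move=> Ax; apply: mem_set; exact: sub_gen_smallest Ax. Qed.

Lemma mem_gen_monoid x : A x -> x \in gen_monoid_set.
Proof. by move=> Ax; apply: mem_set; exact: sub_gen_smallest Ax. Qed.

Definition gen_group : Type := {x : G | x \in gen_group_set}.
HB.instance Definition _ := [isSub of gen_group for sval].
HB.instance Definition _ := [Choice of gen_group by <:].
HB.instance Definition _ :=
  SubChoice_isSubGroup.Build G _ gen_group gen_group_closed.

Definition gen_monoid : Type := {x : G | x \in gen_monoid_set}.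
HB.instance Definition _ := [isSub of gen_monoid for sval].
HB.instance Definition _ := [Choice of gen_monoid by <:].
HB.instance Definition _ :=
  SubChoice_isSubMonoid.Build G _ gen_monoid gen_monoid_closed.

End Generated.

Inductive monoid_cong (Y : Type) (R : seq Y -> seq Y -> Prop) :
    seq Y -> seq Y -> Prop :=
| mcong_rel u v : R u v -> monoid_cong R u v
| mcong_refl u : monoid_cong R u u
| mcong_sym u v : monoid_cong R u v -> monoid_cong R v u
| mcong_trans v u w :
    monoid_cong R u v -> monoid_cong R v w -> monoid_cong R u w
| mcong_cat u u' v v' :
    monoid_cong R u u' -> monoid_cong R v v' ->
    monoid_cong R (u ++ v) (u' ++ v').

Definition word_eval (M : monoidType) (Y : Type) (phi : Y -> M) (w : seq Y) :
  M := \prod_(y <- w) phi y.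

(* M = < phi(y), y in Y : phi(u) = phi(v) for R u v >: the morphism from the  *)
(* free monoid [seq Y] is onto and its kernel is the congruence generated   *)
(* by R.                                                                      *)
Definition has_presentation (M : monoidType) (Y : Type) (phi : Y -> M)
    (R : seq Y -> seq Y -> Prop) : Prop :=
  (forall m : M, exists w : seq Y, word_eval phi w = m) /\
  (forall u v : seq Y,
     word_eval phi u = word_eval phi v <-> monoid_cong R u v).

Definition commutations (Y : Type) (C : Y -> Y -> Prop) (u v : seq Y) : Prop :=
  exists x y : Y, [/\ C x y, u = [:: x; y] & v = [:: y; x]].

Definition trace_monoid (M : monoidType) : Prop :=
  exists (Y : finType) (C : Y -> Y -> Prop) (phi : Y -> M),
    has_presentation phi (commutations C).

(* The alphabet X is 'I_d, so that letters are numbered from 0 to d - 1.      *)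

Definition tree_edge (d : nat) (u v : seq 'I_d) : bool :=
  [exists x, (v == rcons u x) || (u == rcons v x)].

Record tree_aut (d : nat) := TreeAut {
  tree_fun :> seq 'I_d -> seq 'I_d;
  tree_fun_bij : bijective tree_fun;
  tree_fun_root : tree_fun [::] = [::];
  tree_fun_edge : forall u v,
    tree_edge (tree_fun u) (tree_fun v) = tree_edge u v
}.

Section TreeAutGroup.
Variable d : nat.
Implicit Types g h k : tree_aut d.

Lemma tree_aut_ext g h : g =1 h -> g = h.
Proof.
case: g => g gb g1 ge; case: h => h hb h1 he /= /funext gh; subst h.
by congr TreeAut; exact: Prop_irrelevance.
Qed.

HB.instance Definition _ := gen_eqMixin (tree_aut d).
HB.instance Definition _ := gen_choiceMixin (tree_aut d).

Definition tree_one : tree_aut d :=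
  @TreeAut d id (Bijective (frefl id) (frefl id)) erefl
    (fun _ _ => erefl).

Lemma tree_mul_edge g h u v : tree_edge (h (g u)) (h (g v)) = tree_edge u v.
Proof. by rewrite !tree_fun_edge. Qed.

Lemma tree_mul_root g h : h (g [::]) = [::].
Proof. by rewrite !tree_fun_root. Qed.

(* The left factor acts first: (g * h) u = h (g u).                           *)
Definition tree_mul g h : tree_aut d :=
  @TreeAut d (fun u => h (g u)) (bij_comp (tree_fun_bij h) (tree_fun_bij g))
    (tree_mul_root g h) (tree_mul_edge g h).

Lemma tree_inv_subproof g : {h : tree_aut d | cancel g h & cancel h g}.
Proof.
apply: cid2; have [f fK Kf] := tree_fun_bij g.
have f1 : f [::] = [::] by rewrite -{1}(tree_fun_root g) fK.
have fe u v : tree_edge (f u) (f v) = tree_edge u v.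
  by rewrite -(tree_fun_edge g) !Kf.
by exists (TreeAut (Bijective Kf fK) f1 fe).
Qed.

Definition tree_inv g : tree_aut d := s2val (tree_inv_subproof g).

Lemma tree_mulA : associative tree_mul.
Proof. by move=> g h k; exact: tree_aut_ext. Qed.

Lemma tree_1mul : left_id tree_one tree_mul.
Proof. by move=> g; exact: tree_aut_ext. Qed.

Lemma tree_mul1 : right_id tree_one tree_mul.
Proof. by move=> g; exact: tree_aut_ext. Qed.

Lemma tree_Vmul : left_inverse tree_one tree_inv tree_mul.
Proof.
move=> g; apply: tree_aut_ext => u /=.
by rewrite /tree_inv; case: tree_inv_subproof => h /= _ ->.
Qed.

Lemma tree_mulV : right_inverse tree_one tree_inv tree_mul.
Proof.
move=> g; apply: tree_aut_ext => u /=.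
by rewrite /tree_inv; case: tree_inv_subproof => h /= ->.
Qed.

HB.instance Definition _ := isGroup.Build (tree_aut d)
  tree_mulA tree_1mul tree_mul1 tree_Vmul tree_mulV.

End TreeAutGroup.

Section Generators.
Variable d : nat.
Implicit Types (i : 'I_d) (u v : seq 'I_d).

(* [ordS i] is i + 1 modulo d: writing i' for it, a_i exchanges i and i', with*)
(* a_i|_i = a_i, a_i|_i' = a_i' and trivial sections at the other letters; the*)
(* generator a_d is the case where i' wraps around to the first letter.       *)
Fixpoint gen_fun i u : seq 'I_d :=
  if u is x :: v then
    if x == i then ordS i :: gen_fun i v
    else if x == ordS i then i :: gen_fun (ordS i) v
    else x :: v
  else [::].

Fixpoint gen_inv i u : seq 'I_d :=
  if u is x :: v then
    if x == ordS i then i :: gen_inv i v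
    else if x == i then ordS i :: gen_inv (ordS i) v
    else x :: v
  else [::].

Lemma gen_funK i : cancel (gen_fun i) (gen_inv i).
Proof.
move=> u; elim: u i => //= x v IHv i.
have [->|xi] := eqVneq x i; first by rewrite /= eqxx IHv.
have [->|xi'] := eqVneq x (ordS i); last by rewrite /= (negPf xi') (negPf xi).
rewrite /= eqxx; have [i'|_] := eqVneq i (ordS i); last by rewrite IHv.
by rewrite -i' IHv.
Qed.

Lemma gen_invK i : cancel (gen_inv i) (gen_fun i).
Proof.
move=> u; elim: u i => //= x v IHv i.
have [->|xi'] := eqVneq x (ordS i); first by rewrite /= eqxx IHv.
have [->|xi] := eqVneq x i; last by rewrite /= (negPf xi') (negPf xi).
rewrite /= eqxx; have [i'|_] := eqVneq (ordS i) i; last by rewrite IHv.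
by rewrite {1}i' -{2}i' IHv.
Qed.

Lemma gen_fun_rcons i u x :
  exists y, gen_fun i (rcons u x) = rcons (gen_fun i u) y.
Proof.
elim: u i => [|z u IHu] i /=.
  by case: ifP => _; [exists (ordS i)|case: ifP => _; [exists i|exists x]].
case: ifP => _; first by have [y ->] := IHu i; exists y.
by case: ifP => _; [have [y ->] := IHu (ordS i); exists y|exists x].
Qed.

Lemma gen_inv_rcons i u x :
  exists y, gen_inv i (rcons u x) = rcons (gen_inv i u) y.
Proof.
elim: u i => [|z u IHu] i /=.
  by case: ifP => _; [exists i|case: ifP => _; [exists (ordS i)|exists x]].
case: ifP => _; first by have [y ->] := IHu i; exists y.
by case: ifP => _; [have [y ->] := IHu (ordS i); exists y|exists x].
Qed.

Lemma gen_fun_edge i u v :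
  tree_edge (gen_fun i u) (gen_fun i v) = tree_edge u v.
Proof.
have edgeS (f : seq 'I_d -> seq 'I_d) :
    (forall w x, exists y, f (rcons w x) = rcons (f w) y) ->
    forall w w', tree_edge w w' -> tree_edge (f w) (f w').
  move=> f_rcons w w' /existsP[x /orP[]/eqP->].
    by have [y ->] := f_rcons w x; apply/existsP; exists y; rewrite eqxx.
  by have [y ->] := f_rcons w' x; apply/existsP; exists y; rewrite eqxx orbT.
apply/idP/idP => [/(edgeS _ (gen_inv_rcons i))|/(edgeS _ (gen_fun_rcons i))//].
by rewrite !gen_funK.
Qed.

Definition tree_gen i : tree_aut d :=
  @TreeAut d (gen_fun i) (Bijective (gen_funK i) (gen_invK i)) erefl
    (gen_fun_edge i).

Definition Gd : groupType := gen_group (range tree_gen).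

Lemma tree_gen_mem i : tree_gen i \in gen_group_set (range tree_gen).
Proof. by apply: mem_gen_group; exists i. Qed.

Definition Gd_gen i : Gd := exist _ (tree_gen i) (tree_gen_mem i).

Definition Sd : monoidType := gen_monoid (range Gd_gen).

Lemma Gd_gen_mem i : Gd_gen i \in gen_monoid_set (range Gd_gen).
Proof. by apply: mem_gen_monoid; exists i. Qed.

Definition Sd_gen i : Sd := exist _ (Gd_gen i) (Gd_gen_mem i).

End Generators.

(* Main.v *)
Require Import Defs.
From mathcomp Require Import all_boot ssrint.
From mathcomp Require Import classical_sets zify.

Set Implicit Arguments.
Unset Strict Implicit.
Unset Printing Implicit Defensive.

(** Think of d tokens sitting on the d positions of a cycle.  The letter a_i
    swaps the tokens at positions i and i + 1, and the section of a_i at each of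
    these two positions is the generator indexed by that position.  Hence the
    section of a word w at x is again a word: the list of the positions that the
    token starting at x leaves, one for each of its moves.  Consecutive letters
    of this section word are neighbours on the cycle, so they never commute, and
    such a rigid word is alone in its trace class ([monoid_cong_sorted]).

    The commutations clearly hold in the group.  For the converse, let v and w
    be words with the same action and argue by induction on their total length
    ([act_cong]).  The sections of v and w at x have the same action.  By
    [act_id_nil] no nonempty word acts trivially, so these sections are both
    empty or both start with a_x.  In the second case, cancel a_x: the shorter
    words that remain are trace equivalent by induction, hence equal since they
    are rigid.  Together with the common final position, this shows that every
    token follows the same route under v and under w.  If v = a_i v', then the
    first moves under w of the tokens at i and i + 1 swap the two, and this forces
    w to be trace equivalent to a word a_i w' ([cong_first_letter]).  Cancelling
    a_i and using the induction again finishes the proof.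

    For [act_id_nil], take a shortest nonempty word a_i w acting trivially.
    The tokens other than i and i + 1 have sections of length less than that of
    the word, so they never move, which leaves a_i as the only possible letter.
    But then the section at i is a trivial word of no greater length involving
    both a_i and a_(i + 1), to which the same argument applies. *)

(** For a rigid word, one whose consecutive letters are all related by [adj],
    no defining relation applies anywhere.  The disjunction makes the claim
    symmetric, so that it passes through the symmetry and transitivity rules. *)
Lemma monoid_cong_sorted (Y : eqType) (C : Y -> Y -> Prop) (adj : rel Y) :
    (forall x y, C x y -> ~~ adj x y && ~~ adj y x) ->
  forall u v, monoid_cong (commutations C) u v ->
  sorted adj u || sorted adj v -> u = v.
Proof.
move=> Cadj u v; elim=> {u v}.
- by move=> _ _ [x [y [/Cadj/andP[xy yx] -> ->]]]; rewrite /= (negPf xy) (negPf yx).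
- by [].
- by move=> u v _ IH; rewrite orbC => /IH.
- move=> v u w _ IHu _ IHv /orP[su|sw].
    have uv : u = v by apply: IHu; rewrite su.
    by rewrite uv; apply: IHv; rewrite -uv su.
  have vw : v = w by apply: IHv; rewrite sw orbT.
  by rewrite -vw; apply: IHu; rewrite vw sw orbT.
- move=> u u' v v' _ IHu _ IHv /orP[]/cat_sorted2[su sv];
    by rewrite IHu ?su ?orbT // IHv ?sv ?orbT.
Qed.

Section Words.
Variable d : nat.
Implicit Types (i j x y z : 'I_d) (u v w : seq 'I_d).

Definition cyc_adj : rel 'I_d := fun x y => (y == ordS x) || (x == ordS y).

Definition act w u := foldl (fun u' i => gen_fun i u') u w.

(** The route of the token that starts at x while the letters of w are applied
    in turn: its successive positions, without the starting one.  Thus the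
    section of w at x is [belast x (trail w x)]. *)
Fixpoint trail w x : seq 'I_d :=
  if w is i :: w' then
    if x == i then ordS i :: trail w' (ordS i)
    else if x == ordS i then i :: trail w' i
    else trail w' x
  else [::].

(** The wreath recursion of a word. *)
Lemma act_cons w x v :
  act w (x :: v) = last x (trail w x) :: act (belast x (trail w x)) v.
Proof.
elim: w x v => //= i w IHw x v; rewrite /act /= -!/(act _ _).
have [->|_] := eqVneq x i; first by rewrite IHw.
by have [->|_] := eqVneq x (ordS i); rewrite IHw.
Qed.

Lemma size_trail w x : size (trail w x) <= size w.
Proof.
elim: w x => //= i w IHw x.
by do 2?[case: ifP => _; first exact: IHw]; exact: leqW.
Qed.

Lemma trail_path w x : path cyc_adj x (trail w x).
Proof.
elim: w x => //= i w IHw x.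
have [->|_] := eqVneq x i; first by rewrite /= IHw /cyc_adj eqxx.
by have [->|_] := eqVneq x (ordS i); rewrite /= IHw // /cyc_adj eqxx orbT.
Qed.

Lemma trail_nil w j : j \in w -> forall x, trail w x = [::] ->
  (x != j) && (x != ordS j).
Proof.
move=> jw x; elim: w jw => //= i w IHw; rewrite inE.
have [//|xi] := eqVneq x i; have [//|xi'] := eqVneq x (ordS i).
by case/predU1P => [->|/IHw//]; rewrite xi xi'.
Qed.

Lemma act_cancel i v w : act (i :: v) =1 act (i :: w) -> act v =1 act w.
Proof. by move=> vw u; move: (vw (gen_inv i u)); rewrite /act /= gen_invK. Qed.

Lemma act_section v w x : act v =1 act w ->
  last x (trail v x) = last x (trail w x) /\
  act (belast x (trail v x)) =1 act (belast x (trail w x)).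
Proof.
move=> vw; split=> [|u].
  by have := vw [:: x]; rewrite !act_cons => -[].
by have := vw (x :: u); rewrite !act_cons => -[].
Qed.

Hypothesis d_gt2 : 2 < d.

Lemma ordS_neq i : ordS i != i.
Proof.
rewrite -val_eqE /=; have [e|ne] := eqVneq i.+1 d.
  by rewrite e modnn; lia.
by rewrite modn_small; have := ltn_ord i; lia.
Qed.

Lemma ordSS_neq i : ordS (ordS i) != i.
Proof.
have id := ltn_ord i; rewrite -val_eqE /=; have [e|ne] := eqVneq i.+1 d.
  by rewrite e modnn modn_small; lia.
rewrite (@modn_small i.+1); last by lia.
have [e|ne'] := eqVneq i.+2 d; first by rewrite e modnn; lia.
by rewrite modn_small; lia.
Qed.

(** The supports {i, i + 1} and {j, j + 1} of a_i and a_j are disjoint exactly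
    when i and j are neither equal nor neighbours on the cycle. *)
Lemma farE i j : (1 < `|j - i| < d - 1) = (i != j) && ~~ cyc_adj i j.
Proof.
have [id jd] := (ltn_ord i, ltn_ord j).
rewrite /cyc_adj -!val_eqE /=.
have [ei|ni] := eqVneq i.+1 d; have [ej|nj] := eqVneq j.+1 d;
  rewrite ?ei ?ej ?modnn ?(@modn_small i.+1) ?(@modn_small j.+1); lia.
Qed.

Local Notation far := (fun i j : 'I_d => 1 < `|j - i| < d - 1).
Local Notation "v ~ w" := (monoid_cong (commutations far) v w)
  (at level 70).

Lemma gen_fun_comm i j u :
  far i j -> gen_fun j (gen_fun i u) = gen_fun i (gen_fun j u).
Proof.
rewrite /= farE /cyc_adj negb_or => /and3P[ij ji' ij'].
have i'j : (ordS i == j) = false by rewrite eq_sym (negPf ji').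
have j'i : (ordS j == i) = false by rewrite eq_sym (negPf ij').
have ji : (j == i) = false by rewrite eq_sym (negPf ij).
have i'j' : (ordS i == ordS j) = false by rewrite (can_eq (@ordSK _)) (negPf ij).
have j'i' : (ordS j == ordS i) = false by rewrite eq_sym.
case: u => //= x u; case: (eqVneq x i) => [->|xi].
  by rewrite (negPf ij) (negPf ij') /= eqxx i'j i'j'.
case: (eqVneq x (ordS i)) => [->|xi'].
  by rewrite i'j i'j' /= (negPf (ordS_neq i)) eqxx (negPf ij) (negPf ij').
rewrite /=; case: (x == j); first by rewrite /= j'i j'i'.
case: (x == ordS j); first by rewrite /= ji (negPf ji').
by rewrite /= (negPf xi) (negPf xi').
Qed.

Lemma cong_act v w : v ~ w -> act v =1 act w.
Proof.
elim=> {v w}.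
- by move=> _ _ [i [j [ij -> ->]]] u; rewrite /act /= gen_fun_comm.
- by [].
- by move=> v w _ IH u; rewrite IH.
- by move=> w v u _ IHv _ IHw x; rewrite IHv.
- by move=> u u' v v' _ IHu _ IHv x; rewrite /act !foldl_cat -!/(act _ _) IHu IHv.
Qed.

(** The tokens other than i and i + 1 are not moved by the first letter, so
    their sections are short enough for the hypothesis: they stay where they
    are.  Any letter a_j with j <> i would move such a token, namely the one at
    j, or the one at j + 1 when j = i + 1; this last case requires i + 2 <> i. *)
Lemma act_id_letters n i w :
    (forall v, size v <= n -> act v =1 id -> v = [::]) ->
    size w <= n -> act (i :: w) =1 id -> {in w, forall j, j = i}.
Proof.
move=> IH wn w1 j jw.
have fix_z z : z != i -> z != ordS i -> trail w z = [::].
  move=> zi zi'; have [] := @act_section (i :: w) [::] z w1.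
  rewrite /= (negPf zi) (negPf zi') => _ /IH t0.
  apply: size0nil; rewrite -(size_belast z) t0 // size_belast.
  exact: leq_trans (size_trail _ _) wn.
apply/eqP/contraT => ji.
have [ji'|ji'] := eqVneq j (ordS i).
  have /(trail_nil jw) : trail w (ordS j) = [::].
    by apply: fix_z; rewrite ji' ?ordSS_neq // ordS_neq.
  by rewrite eqxx andbF.
by have /(trail_nil jw) := fix_z j ji ji'; rewrite eqxx.
Qed.

Lemma act_id_nil w : act w =1 id -> w = [::].
Proof.
have [n] := ubnP (size w); elim: n w => // n IHn [|i w] //=.
rewrite ltnS => wn w1.
have IH v : size v <= n.-1 -> act v =1 id -> v = [::].
  by move=> vn; apply: IHn; lia.
(* The word is a power of a_i, and at least the square: a_i moves i. *)
have wi : {in w, forall j, j = i}.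
  by apply: act_id_letters IH _ w1; lia.
have [] := @act_section (i :: w) [::] i w1; rewrite /= eqxx.
case: w wn w1 wi => [|j w] wn w1 wi.
  by move/eqP; rewrite (negPf (ordS_neq i)).
rewrite (wi j (mem_head _ _)) /= (negPf (ordS_neq i)) eqxx /= => _ sec1.
(* The section at i starts with a_i and a_(i + 1). *)
have sec_size : size (ordS i :: belast i (trail w i)) <= n.-1.
  by rewrite /= size_belast; have := size_trail w i; move: wn => /=; lia.
have /(_ (ordS i) (mem_head _ _))/eqP := act_id_letters IH sec_size sec1.
by rewrite (negPf (ordS_neq i)).
Qed.

(** A letter of w preceding the first a_i cannot be a_(i - 1) or a_(i + 1),
    since one of the two tokens would then make its first move in the wrong
    direction.  So a_i commutes with all the letters before it and
    can be moved to the front. *)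
Lemma cong_first_letter i w p q :
    trail w i = ordS i :: p -> trail w (ordS i) = i :: q ->
  exists2 w', size w = (size w').+1 & w ~ i :: w'.
Proof.
elim: w => //= j w IHw.
have [<- _ _|ji] := eqVneq i j; first by exists w => //; exact: mcong_refl.
have [-> [e]|ij'] := eqVneq i (ordS j).
  by have := ordSS_neq j; rewrite -e eqxx.
have [<- _ [e]|ji'] := eqVneq (ordS i) j.
  by have := ordSS_neq i; rewrite e eqxx.
rewrite (can_eq (@ordSK _)) (negPf ji) => ti ti'.
have [w' sw ww'] := IHw ti ti'; exists (j :: w'); first by rewrite sw.
apply: (mcong_trans (v := [:: j; i] ++ w')).
  exact: (mcong_cat (u := [:: j]) (u' := [:: j])) (mcong_refl _ _) ww'.
apply: (mcong_cat (u' := [:: i; j])); last exact: mcong_refl.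
apply: mcong_rel; exists j, i; split=> //.
by rewrite farE /cyc_adj negb_or eq_sym ji ij' eq_sym ji'.
Qed.

Lemma act_cong v w : act v =1 act w -> v ~ w.
Proof.
have [n] := ubnP (size v + size w); elim: n v w => // n IHn v w.
rewrite ltnS => vwn vw.
(* Cancelling the common first letter x of the two sections makes them shorter
   even when every letter of v and w moves the token x. *)
have eq_trail x : trail v x = trail w x.
  have [] := act_section x vw.
  have := (trail_path v x, trail_path w x).
  have := (size_trail v x, size_trail w x).
  case: (trail v x) (trail w x) => [|y p] [|z q] //= [sp sq].
  - by move=> _ _ /fsym /act_id_nil.
  - by move=> _ _ /act_id_nil.
  case=> /andP[_ yp] _ e_last /act_cancel/IHn; rewrite !size_belast => pq.
  rewrite (lastI y) (lastI z) e_last; congr rcons.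
  apply: (monoid_cong_sorted (adj := cyc_adj)) (pq _) _.
  - by move=> i j; rewrite farE => /andP[_ ij]; rewrite ij /cyc_adj orbC.
  - lia.
  - apply/orP; left; have : sorted cyc_adj (y :: p) by [].
    by rewrite lastI -cats1 => /cat_sorted2[].
case: v vwn vw eq_trail => [|i v] vwn vw eq_trail.
  by rewrite (act_id_nil (fsym vw)); exact: mcong_refl.
have [ti ti'] := (esym (eq_trail i), esym (eq_trail (ordS i))).
move: ti ti'; rewrite /= eqxx (negPf (ordS_neq i)) eqxx => ti ti'.
have [w' sw ww'] := cong_first_letter ti ti'.
have vw' : v ~ w'.
  apply: IHn; first by move: vwn; rewrite sw /=; lia.
  by apply: (@act_cancel i) => u; rewrite vw; exact: cong_act.
apply: mcong_trans (mcong_sym ww').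
exact: (mcong_cat (u := [:: i]) (u' := [:: i])) (mcong_refl _ _) vw'.
Qed.

Lemma word_eval_act w u : val (val (word_eval (@Sd_gen d) w)) u = act w u.
Proof.
rewrite /word_eval; elim: w u => [|i w IHw] u; first by rewrite big_nil.
by rewrite big_cons /= -[RHS]IHw.
Qed.

Lemma word_eval_eq v w :
  word_eval (@Sd_gen d) v = word_eval (@Sd_gen d) w <-> act v =1 act w.
Proof.
split=> [vw u|vw]; first by rewrite -!word_eval_act vw.
by do 2!apply: val_inj; apply: tree_aut_ext => u; rewrite !word_eval_act.
Qed.

Lemma word_eval_onto (m : Sd d) : exists w, word_eval (@Sd_gen d) w = m.
Proof.
case: m => g gS.
pose values : set (Gd d) :=
  [set h | exists w, val (word_eval (@Sd_gen d) w) = h]%classic.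
suff [w e] : values g by exists w; apply: val_inj.
move: (set_mem gS) => /(_ values); apply; split; last first.
  by move=> _ [i _ <-]; exists [:: i]; rewrite /word_eval big_seq1.
split; first by apply/mem_set; exists [::]; rewrite /word_eval big_nil.
move=> x y /set_mem[v <-] /set_mem[w <-]; apply/mem_set; exists (v ++ w).
by rewrite /word_eval big_cat.
Qed.

End Words.

Theorem theorem3p5 (d : nat) (hd3 : 3 <= d) (hdodd : odd d) :
  trace_monoid (Sd d) /\
  has_presentation (@Sd_gen d)
    (commutations (fun i j : 'I_d => 1 < `|j - i| < d - 1)).
Proof.
have pres : has_presentation (@Sd_gen d)
    (commutations (fun i j : 'I_d => 1 < `|j - i| < d - 1)).
  split=> [|v w]; first exact: word_eval_onto.
  split=> [/word_eval_eq|/cong_act vw]; first exact: act_cong.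
  by apply/word_eval_eq; exact: vw.
by split=> //; exists 'I_d, (fun i j : 'I_d => 1 < `|j - i| < d - 1), (@Sd_gen d).
Qed.
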